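(* Let $G=(V,E)$ be a directed graph (an undirected graph is represented by replacing each undirected edge with one directed edge in each direction), let $x\in V$, and let $\nu,k$ be positive integers with $\nu k=O(|E|)$. Consider the randomized algorithm $\textsc{Local2+}_G(x,\nu,k)$ defined as follows. (If the minimum out-degree of $G$ is less than $k$, $k$ is first replaced by the minimum degree, and the trivial cut is returned if no smaller cut is found.) Each vertex $v$ carries a remaining capacity $c(v)$, initialized to $c(v)=\deg^{\mathrm{out}}(v)$. Repeat the following for $k$ iterations, always working on the current (possibly modified) graph: (1) Choose an integer $\tau$ uniformly at random from $\{1,\dots,8\nu\}$. Grow a depth-first-search tree $T$ from $x$; at any time let $v_1,\dots,v_i$ be the sequence of vertices visited so far. Let $y$ be $v_i$ for the first $i$ with $\sum_{j\le i}c(v_j)\ge\tau$. As soon as $\sum_{j\le i}c(v_j)\ge 8\nu$, stop the search and update capacities: set $c(v_j)\gets 0$ for all $j<i$ and $c(v_i)\gets\sum_{j\le i}c(v_j)-8\nu$. (2) If the search terminates normally (i.e. it finishes exploring everything reachable from $x$ without the stopping condition being triggered), return the set $V(T)$ of visited vertices. (3) Unless this is the last iteration, reverse the direction of every edge on the unique path from $x$ to $y$ in $T$. If all $k$ iterations finish without returning, return $\bot$. Then $\textsc{Local2+}$ is a LocalEC algorithm with $(\nu k^2,\nu k,\nu)$-complexity.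
   Context: For vertex sets $S,T$, $E(S,T)$ denotes the set of edges from $S$ to $T$, and $\mathrm{vol}^{\mathrm{out}}(S)=\sum_{v\in S}\deg^{\mathrm{out}}(v)$. An algorithm $\mathcal A$ is called LocalEC if, given a vertex $x$ of a graph $G=(V,E)$ and parameters $\nu,k$ with $\nu k=O(|E|)$, it either outputs a vertex set $S$ with $x\in S$ and $|E(S,V\setminus S)|<k$, or outputs the symbol $\bot$, certifying that there is no non-empty vertex set $S$ with $x\in S$, $\mathrm{vol}^{\mathrm{out}}(S)\le\nu$ and $|E(S,V\setminus S)|<k$; one-sided error is allowed: if such a set $S$ exists, $\bot$ is returned with probability at most $1/2$. A LocalEC algorithm $\mathcal A(x,\nu,k)$ has $(t,s_e,s_v)$-complexity if it terminates in $O(t)$ time, accesses at most $O(s_e)$ distinct edges, and accesses at most $O(s_v)$ distinct vertices.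
   Formalization: The O(ν) vertex bound is proved when min(k, min out-degree)=O(ν), as it fails otherwise; if the min out-degree is below k, LocalEC holds for the reduced k and the output, maybe the trivial cut without x, has fewer than k out-edges; the min-degree vertex is assumed known. *)

(* Defs.v *)
From mathcomp Require Export all_boot all_order all_algebra.

Set Implicit Arguments.
Unset Strict Implicit.
Unset Printing Implicit Defensive.

Import Order.TTheory GRing.Theory Num.Theory.

Section Digraph.
Variables (V : finType) (e : rel V).

Definition edges : {set V * V} := [set p | e p.1 p.2].
Definition cut_edges (S T : {set V}) : {set V * V} :=
  [set p in edges | (p.1 \in S) && (p.2 \in T)].
Definition outdeg (v : V) : nat := #|[set p in edges | p.1 == v]|.
Definition vol_out (S : {set V}) : nat := \sum_(v in S) outdeg v.
(* [x] only witnesses that the vertex set is non-empty. *)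
Definition min_vertex (x : V) : V := [arg min_(v < x) outdeg v].
Definition min_outdeg (x : V) : nat := outdeg (min_vertex x).

(* A modified graph is the original one in which the edges of the set [R] are
   reversed.  An edge keeps its name in [edges] whatever its orientation, so
   that reversals may create parallel edges. *)
Definition etail (R : {set V * V}) (p : V * V) : V :=
  if p \in R then p.2 else p.1.
Definition ehead (R : {set V * V}) (p : V * V) : V :=
  if p \in R then p.1 else p.2.
Definition out_edges (R : {set V * V}) (v : V) : {set V * V} :=
  [set p in edges | etail R p == v].

End Digraph.

(* [scan h R v] is the order in which the out-edges of [v] are explored when
   the reversed edges are [R] and the values drawn in the previous iterations
   are [h].  It is arbitrary: any order of the adjacency lists, and any way of
   maintaining it under reversals, is covered.  It cannot depend on the value
   drawn in the current iteration. *)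
Record instance := Instance {
  vert : finType;
  adj : rel vert;
  start : vert;
  nu : nat;
  conn : nat;
  scan : seq nat -> {set vert * vert} -> vert -> seq (vert * vert);
  scan_perm : forall h R v, perm_eq (scan h R v) (enum (out_edges adj R v))
}.

Arguments adj : clear implicits.
Arguments scan : clear implicits.

Definition with_conn (I : instance) (k : nat) : instance :=
  {| start := start I; nu := nu I; conn := k; scan_perm := @scan_perm I |}.

(* Elementary operations, each of unit cost: drawing a random integer; reading
   or writing the data (degree, capacity, mark, tree edge, running sum) of a
   vertex; reading or reversing an edge of an adjacency list. *)
Inductive op (V : Type) :=
  | OpDraw
  | OpVertex of V
  | OpEdge of V * V.
Arguments OpDraw {V}.

Definition op_vertex (V : Type) (o : op V) : option V :=
  if o is OpVertex v then Some v else None.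
Definition op_edge (V : Type) (o : op V) : option (V * V) :=
  if o is OpEdge p then Some p else None.

(* The output [None] stands for the symbol bottom. *)
Record run (V : finType) := Run {
  output : option {set V};
  trace : seq (op V)
}.
Arguments output {V}.
Arguments trace {V}.

Definition run_time (V : finType) (r : run V) : nat := size (trace r).
Definition run_edges (V : finType) (r : run V) : nat :=
  size (undup (pmap (@op_edge V) (trace r))).
Definition run_vertices (V : finType) (r : run V) : nat :=
  size (undup (pmap (@op_vertex V) (trace r))).

(* The coin tosses are uniformly distributed over a finite type. *)
Record randalg := RandAlg {
  coins : instance -> finType;
  exec : forall I : instance, coins I -> run (vert I)
}.
Arguments exec : clear implicits.

Definition Pr (Omega : finType) (P : pred Omega) : rat :=
  (#|[set w | P w]|%:R / #|Omega|%:R)%R.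

Definition LocalEC_at (A : randalg) (I : instance) : Prop :=
  (forall (w : coins A I) (S : {set vert I}), output (exec A I w) = Some S ->
     start I \in S /\ #|cut_edges (adj I) S (~: S)| < conn I) /\
  ((exists S : {set vert I},
      [/\ S != set0, start I \in S, vol_out (adj I) S <= nu I
        & #|cut_edges (adj I) S (~: S)| < conn I]) ->
   (Pr (fun w : coins A I => output (exec A I w) == None) <= 1 / 2%:R)%R).

Definition LocalEC (D : instance -> Prop) (A : randalg) : Prop :=
  forall I, D I -> LocalEC_at A I.

Definition cost_bigO (D : instance -> Prop) (A : randalg)
    (cost : forall V : finType, run V -> nat) (f : instance -> nat) : Prop :=
  exists C : nat, forall I, D I -> forall w : coins A I,
    cost (vert I) (exec A I w) <= C * f I.

Definition instance_min_outdeg (I : instance) : nat :=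
  min_outdeg (adj I) (start I).

(* Parameters [nu], [k] with [nu k = O(|E|)], the implied constant being [C]. *)
Definition admissible (C : nat) (I : instance) : Prop :=
  [/\ 0 < nu I, 0 < conn I & nu I * conn I <= C * #|edges (adj I)|].

Section Search.
Variables (V : finType) (x : V) (nu : nat).
Variable scan : seq nat -> {set V * V} -> V -> seq (V * V).

(* [tree] lists the visited vertices, the latest first, each with the edge by
   which it was reached; [csum] is the sum of their capacities. *)
Record dfs_state := DfsState {
  tree : seq (V * option (V * V));
  csum : nat;
  dtrace : seq (op V)
}.

Definition visited (s : dfs_state) : seq V := unzip1 (tree s).
Definition stopped (s : dfs_state) : bool := 8 * nu <= csum s.

Definition visit (c : V -> nat) (s : dfs_state) (v : V)
    (a : option (V * V)) : dfs_state :=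
  DfsState ((v, a) :: tree s) (csum s + c v) (rcons (dtrace s) (OpVertex v)).

(* The fuel [n] bounds the recursion depth; every nested call visits a new
   vertex, so #|V| is never exhausted. *)
Fixpoint dfs (n : nat) (c : V -> nat) (R : {set V * V})
    (nbr : V -> seq (V * V)) (s : dfs_state) (v : V)
    (a : option (V * V)) : dfs_state :=
  if n is n'.+1 then
    let explore (s : dfs_state) (p : V * V) :=
      if stopped s then s else
      let w := ehead R p in
      let s' := DfsState (tree s) (csum s)
                  (dtrace s ++ [:: OpEdge p; OpVertex w]) in
      if w \in visited s' then s' else dfs n' c R nbr s' w (Some p) in
    foldl explore (visit c s v a) (nbr v)
  else s.

Fixpoint tree_path (R : {set V * V}) (t : seq (V * option (V * V)))
    (y : V) : seq (V * V) :=
  if t is (w, a) :: t' then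
    if w == y then
      if a is Some p then rcons (tree_path R t' (etail R p)) p else [::]
    else tree_path R t' y
  else [::].

(* The first v_i, in order of visit, with c(v_1) + ... + c(v_i) >= tau. *)
Definition crossing (c : V -> nat) (tau : nat) (s : dfs_state) : V :=
  let vs := rev (visited s) in
  nth x vs (find (fun i => tau <= \sum_(v <- take i.+1 vs) c v)
                 (iota 0 (size vs))).

Definition new_cap (c : V -> nat) (s : dfs_state) : V -> nat :=
  fun v => if v \in behead (visited s) then 0
           else if v == head x (visited s) then csum s - 8 * nu
           else c v.

Definition reverse_edges (R : {set V * V}) (ps : seq (V * V)) : {set V * V} :=
  [set p | (p \in R) (+) (p \in ps)].

(* One iteration for each element of [taus], the values of tau still to be
   used; [h] contains those already used. *)
Fixpoint iterations (h : seq nat) (R : {set V * V}) (c : V -> nat)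
    (taus : seq nat) : run V :=
  if taus is tau :: taus' then
    let s := dfs #|V| c R (scan h R) (DfsState [::] 0 [::]) x None in
    let tr := OpDraw :: dtrace s ++ [seq OpVertex v | v <- visited s] in
    if stopped s then
      let ps := if taus' is [::] then [::]
                else tree_path R (tree s) (crossing c tau s) in
      let r := iterations (rcons h tau) (reverse_edges R ps)
                 (new_cap c s) taus' in
      Run (output r) (tr ++ [seq OpEdge p | p <- ps] ++ trace r)
    else Run (Some [set v in visited s]) tr
  else Run None [::].

End Search.

(* The [k] iterations for the given [k]: coordinate [i] of the coin tosses,
   plus one, is the value of tau in {1, ..., 8 nu} in iteration [i]. *)
Definition Local2_iterations : randalg := {|
  coins := fun I => {ffun 'I_(conn I) -> 'I_(8 * nu I)};
  exec := fun I w =>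
    iterations (start I) (nu I) (scan I) [::] set0 (outdeg (adj I))
      [seq (w i : nat).+1 | i <- enum 'I_(conn I)]
|}.

Definition reduced (I : instance) : instance :=
  with_conn I (minn (conn I) (instance_min_outdeg I)).

Definition trivial_cut (I : instance) : {set vert I} :=
  [set min_vertex (adj I) (start I)].

(* A vertex of minimum out-degree is supposed to be known beforehand: it cannot
   be found by a local exploration. *)
Definition Local2plus : randalg := {|
  coins := fun I => coins Local2_iterations (reduced I);
  exec := fun I w =>
    let r : run (vert I) := exec Local2_iterations (reduced I) w in
    if (output r == None) && (instance_min_outdeg I < conn I) then
      Run (Some (trivial_cut I))
        (rcons (trace r) (OpVertex (min_vertex (adj I) (start I))))
    else r
|}.

(* Main.v *)
Require Import Defs.
From mathcomp Require Import all_boot all_order all_algebra.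
From mathcomp Require Import zify.

Set Implicit Arguments.
Unset Strict Implicit.
Unset Printing Implicit Defensive.

(* Fix S containing x, with vol_out S <= nu and out-cut less than k.  Reversing a
   path from x to y lowers the out-cut of S by 1 if y is outside S and leaves it
   unchanged otherwise.  Hence a set closed after i reversals has out-cut at most
   i < k in G, and if no y falls in S then S is closed before the last search,
   which cannot collect 8 nu units of capacity inside S.  The number of values of
   tau that put y in S is the capacity removed from S in that iteration, and at
   most nu units can be removed from S in total; so the failure probability is at
   most nu / (8 nu) = 1/8.  For the cost, k iterations remove 8 nu k units, so the
   vertices of exhausted capacity have total out-degree at most 8 nu k; all edges
   that are read start, in their original orientation, at such vertices. *)

(** * Out-cuts under the reversal of a search-tree path *)

Section ReversedGraph.
Variables (V : finType) (e : rel V).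
Implicit Types (R : {set V * V}) (S : {set V}) (t : seq (V * option (V * V))).

Definition leaves R S (p : V * V) := (etail R p \in S) && (ehead R p \notin S).
Definition enters R S (p : V * V) := (etail R p \notin S) && (ehead R p \in S).
Definition cut_in R S : {set V * V} := [set p in edges e | leaves R S p].

Lemma card_edges_by (f : V * V -> V) (A : {pred V}) :
  #|[set p in edges e | f p \in A]| = \sum_(v in A) #|[set p in edges e | f p == v]|.
Proof.
rewrite -sum1dep_card (partition_big f (mem A)) /= => [|p /andP[] //].
apply: eq_bigr => v vA; rewrite -sum1dep_card; apply: eq_bigl => p.
by rewrite -andbA; case: eqP => [->|]; rewrite ?andbF // vA.
Qed.

Lemma cut_in0 S : cut_in set0 S = cut_edges e S (~: S).
Proof. by apply/setP => p; rewrite !inE /leaves /etail /ehead !inE. Qed.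

(** Edges outside [ps] keep their direction, and an edge of [ps] leaves [S] after the reversal
    exactly when it entered [S] before. The additive form avoids truncated subtraction. *)
Lemma cut_in_reverse R S (ps : seq (V * V)) :
  uniq ps -> {subset ps <= edges e} ->
  #|cut_in (reverse_edges R ps) S| + count (leaves R S) ps =
  #|cut_in R S| + count (enters R S) ps.
Proof.
move=> ups pse; pose P := [set p in ps].
have cE Q (A : pred (V * V)) : 
    (forall p, p \in ps -> leaves Q S p = A p) -> 
    #|cut_in Q S :&: P| = count A ps.
  move=> QA; rewrite -size_filter -(card_uniqP (filter_uniq A ups)).
  apply: eq_card => p; rewrite !inE mem_filter.
  case: (boolP (p \in ps)) => pp; rewrite ?andbF // !andbT QA //.
  by have := pse _ pp; rewrite inE => ->.
rewrite -(cardsID P (cut_in (reverse_edges R ps) S)) -(cardsID P (cut_in R S)).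
rewrite (cE R (leaves R S)) // (cE _ (enters R S)); last first.
  move=> p pp; rewrite /leaves /enters /etail /ehead !inE pp.
  by case: (p \in R); rewrite /= andbC.
suff -> : cut_in (reverse_edges R ps) S :\: P = cut_in R S :\: P.
  by move: (count _ _) #|_| (count _ _) => a b d; lia.
apply/setP => p; rewrite !inE; case: (boolP (p \in ps)) => //= pp.
by rewrite /leaves /etail /ehead !inE (negPf pp) addbF.
Qed.

Fixpoint tree_wf (x : V) R t : bool :=
  if t is (w, a) :: t' then
    if a is Some p then
      [&& p \in edges e, ehead R p == w, etail R p \in unzip1 t' & tree_wf x R t']
    else (t' == [::]) && (w == x)
  else true.

(** [behead] matters: the latest vertex is never the tail of a path edge, so after a stopped search
    all these tails are settled and lose their whole capacity. *)
Lemma tree_path_edges x R t y : tree_wf x R t ->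
  forall p, p \in tree_path R t y ->
  [/\ p \in edges e, etail R p \in behead (unzip1 t) & ehead R p \in unzip1 t].
Proof.
elim: t y => [|[w a] t IH] y //= twf p.
case: a twf => [q /and4P[qe /eqP hq tq twf]|/andP[/eqP-> _]]; last first.
  by case: ifP.
case: ifP => [/eqP wy|_].
  rewrite mem_rcons inE => /orP[/eqP->|]; first by split; rewrite // hq mem_head.
  by case/(IH _ twf) => pe /mem_behead tp hp; split; rewrite // in_cons hp orbT.
by case/(IH _ twf) => pe /mem_behead tp hp; split; rewrite // in_cons hp orbT.
Qed.

Lemma size_tree_path R t y : size (tree_path R t y) <= size t.
Proof.
elim: t y => [|[w a] t IH] y //=.
case: ifP => _; last exact: leqW.
by case: a => [p|//]; rewrite size_rcons ltnS.
Qed.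

Lemma tree_path_uniq x R t y :
  tree_wf x R t -> uniq (unzip1 t) -> uniq (tree_path R t y).
Proof.
elim: t y => [|[w a] t IH] y //= twf /andP[wt ut].
case: a twf => [q /and4P[qe /eqP hq tq twf]|/andP[/eqP-> _]]; last first.
  by case: ifP.
case: ifP => _; last exact: IH.
rewrite rcons_uniq IH // andbT; apply: contra wt => /(tree_path_edges twf)[_ _].
by rewrite hq.
Qed.

(** Along a path that starts in [S], exits and entries alternate, beginning with an exit; there is
    one exit more exactly when the end is outside [S]. *)
Lemma tree_path_crossings x R t y S : tree_wf x R t -> y \in unzip1 t -> x \in S ->
  count (leaves R S) (tree_path R t y) =
  count (enters R S) (tree_path R t y) + (y \notin S).
Proof.
move=> twf yt xS; elim: t y twf yt => [|[w a] t IH] y //=.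
case: a => [q /and4P[qe /eqP hq tq twf]|/andP[/eqP-> /eqP->]] /=; last first.
  by rewrite inE => /eqP->; rewrite eqxx xS.
rewrite inE; case: (eqVneq w y) => [<- _|_ yt]; last exact: IH.
rewrite -!cats1 !count_cat /= !addn0 IH // /leaves /enters hq.
by case: (etail R q \in S); case: (w \in S); rewrite /= ?addn0 ?addn1.
Qed.

Lemma cut_in_tree_path x R t y S :
  tree_wf x R t -> uniq (unzip1 t) -> y \in unzip1 t -> x \in S ->
  #|cut_in (reverse_edges R (tree_path R t y)) S| + (y \notin S) = #|cut_in R S|.
Proof.
move=> twf ut yt xS.
have := @cut_in_reverse R S _ (tree_path_uniq y twf ut)
  (fun p pp => let: And3 pe _ _ := tree_path_edges twf pp in pe).
by rewrite (tree_path_crossings twf yt xS); lia.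
Qed.

End ReversedGraph.

(** * Depth-first search: reachable states, closure and invariants *)

Section DepthFirst.
Variables (V : finType) (e : rel V) (x : V) (nu : nat) (c : V -> nat).
Variables (R : {set V * V}) (nbr : V -> seq (V * V)).
Hypothesis nbrP : forall v, perm_eq (nbr v) (enum (out_edges e R v)).
Implicit Types s : dfs_state V.

Definition probe s (p : V * V) : dfs_state V :=
  DfsState (tree s) (csum s) (dtrace s ++ [:: OpEdge p; OpVertex (ehead R p)]).

(** Single steps of the search, with the recursion and the order of exploration forgotten, so that
    invariants need only be checked step by step. *)
Inductive dfs_reach s : dfs_state V -> Prop :=
| ReachRefl : dfs_reach s s
| ReachProbe s' p of dfs_reach s s' & ~~ stopped nu s' & p \in edges e
    & etail R p \in visited s' & ehead R p \in visited s' :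
    dfs_reach s (probe s' p)
| ReachVisit s' p of dfs_reach s s' & ~~ stopped nu s' & p \in edges e
    & etail R p \in visited s' & ehead R p \notin visited s' :
    dfs_reach s (visit c (probe s' p) (ehead R p) (Some p)).

Lemma dfs_reach_trans s1 s2 s3 :
  dfs_reach s1 s2 -> dfs_reach s2 s3 -> dfs_reach s1 s3.
Proof. by move=> r12; elim=> // *; [apply: ReachProbe | apply: ReachVisit]. Qed.

Lemma dfs_reach_visited s s' : dfs_reach s s' -> {subset visited s <= visited s'}.
Proof. by elim=> // s1 p _ IH _ _ _ _ v /IH vs; rewrite inE vs orbT. Qed.

Lemma dfs_reach_stopped s s' : dfs_reach s s' -> stopped nu s -> s' = s.
Proof. by elim=> // s1 p _ IH ns _ _ _ /[dup] st /IH E; rewrite E st in ns. Qed.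

Lemma dfs_reach_uniq s s' : dfs_reach s s' -> uniq (visited s) -> uniq (visited s').
Proof. by elim=> // s1 p _ IH _ _ _ nv /IH us; rewrite /= nv. Qed.

Lemma dfs_reach_size s s' : dfs_reach s s' -> size (visited s) <= size (visited s').
Proof. by elim=> // s1 p _ IH _ _ _ _; apply: leqW. Qed.

(* The vertex whose capacity triggers the stop is visited but not explored. *)
Definition settled s : seq V :=
  if stopped nu s then behead (visited s) else visited s.
Definition edge_ops s : nat := size (pmap (@op_edge V) (dtrace s)).
Definition settled_deg s : nat := \sum_(v <- settled s) size (nbr v).

Lemma mem_nbr v p : (p \in nbr v) = (p \in edges e) && (etail R p == v).
Proof. by rewrite (perm_mem (nbrP v)) mem_enum inE. Qed.

Definition explore n s (p : V * V) : dfs_state V :=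
  if stopped nu s then s else
  if ehead R p \in visited s then probe s p
  else Defs.dfs nu n c R nbr (probe s p) (ehead R p) (Some p).

(** Closure is claimed only for vertices first visited during the call: those visited before may
    still be under exploration by enclosing calls. *)
Definition closed_above s s' : Prop := forall p, p \in edges e ->
  etail R p \in visited s' -> etail R p \notin visited s -> ehead R p \in visited s'.

(* Every vertex settled by the call accounts for at most its own out-edges: the
   inequality says that edge_ops - settled_deg does not increase, written without
   subtraction. *)
Lemma dfs_correct n s v a : ~~ stopped nu s -> v \notin visited s ->
  uniq (visited s) -> #|V| <= n + size (visited s) ->
  let s' := Defs.dfs nu n c R nbr s v a in
  [/\ dfs_reach (visit c s v a) s',
      edge_ops s' + settled_deg s <= edge_ops s + settled_deg s'
    & ~~ stopped nu s' -> closed_above s s'].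
Proof.
elim: n s v a => [|n IH] s v a ns nv us ltn.
  (* Without fuel the visited vertices would be all of [V], but [v] is not among them. *)
  have := card_uniqP us; have := max_card (mem (visited s)).
  move=> le1 cardE; have : [set w in visited s] = setT.
    by apply/eqP; rewrite eqEcard subsetT cardsT cardsE cardE.
  by move/setP/(_ v); rewrite !inE (negPf nv).
(* Folding over part of the list of [v] may cost [size ps] more reads than the newly settled
   vertices pay for; settling [v] itself covers this surplus. *)
have exploreP : forall ps s1, uniq (visited s1) -> v \in visited s1 ->
    #|V| <= n + size (visited s1) -> {subset ps <= nbr v} ->
    let s' := foldl (explore n) s1 ps in
    [/\ dfs_reach s1 s',
        edge_ops s' + settled_deg s1 <= edge_ops s1 + settled_deg s' + size ps
      & ~~ stopped nu s' -> closed_above s1 s' /\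
          {in ps, forall p, ehead R p \in visited s'}].
  elim=> [|p ps IHps] s1 us1 vs1 ln1 sub /=.
    split; [exact: ReachRefl|by rewrite addn0|].
    by move=> _; split=> // q _ ->.
  have subps : {subset ps <= nbr v}.
    by move=> q qp; apply: sub; rewrite inE qp orbT.
  have := sub p (mem_head _ _); rewrite mem_nbr => /andP[pe /eqP tp].
  have [r1 le1 cl1] :
    [/\ dfs_reach s1 (explore n s1 p),
     edge_ops (explore n s1 p) + settled_deg s1 <=
       (edge_ops s1 + settled_deg (explore n s1 p)).+1
     & ~~ stopped nu (explore n s1 p) -> closed_above s1 (explore n s1 p)
       /\ ehead R p \in visited (explore n s1 p)].
    have eopE : edge_ops (probe s1 p) = (edge_ops s1).+1.
      by rewrite /edge_ops /= pmap_cat size_cat addn1.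
    rewrite /explore; case: ifPn => [st|ns1].
      by split=> [||/negP //]; [exact: ReachRefl|exact: leqnSn].
    case: ifPn => hp.
      split=> [||_].
      - by apply: ReachProbe hp => //; [exact: ReachRefl|rewrite tp].
      - by rewrite eopE addSn.
      - by split=> // q _ ->.
    have [r le cl] := IH (probe s1 p) (ehead R p) (Some p) ns1 hp us1 ln1.
    split=> [||/[dup] nst /cl cl'].
    - apply: dfs_reach_trans r; apply: ReachVisit hp => //; first exact: ReachRefl.
      by rewrite tp.
    - by move: le; rewrite eopE.
    - by split=> //; apply: (dfs_reach_visited r); rewrite inE eqxx.
  have vs2 := dfs_reach_visited r1 vs1.
  have ln2 : #|V| <= n + size (visited (explore n s1 p)).
    by apply: leq_trans ln1 _; rewrite leq_add2l dfs_reach_size.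
  have [r2 le2 cl2] := IHps _ (dfs_reach_uniq r1 us1) vs2 ln2 subps.
  split=> [||ns']; [exact: dfs_reach_trans r2|simpl in *; lia|].
  have ns2 : ~~ stopped nu (explore n s1 p).
    by apply: contra ns' => /[dup] st; move/(dfs_reach_stopped r2) => ->.
  have [clA hA] := cl1 ns2; have [clB hB] := cl2 ns'.
  split=> [q qe tq nq|q].
    case: (boolP (etail R q \in visited (explore n s1 p))) => t2.
      exact: (dfs_reach_visited r2 (clA _ qe t2 nq)).
    exact: clB.
  by rewrite inE => /orP[/eqP->|]; [exact: (dfs_reach_visited r2)|exact: hB].
rewrite /= -/(explore n) => {IH}.
have [||||r le cl] := exploreP (nbr v) (visit c s v a) => //.
- by rewrite /= nv.
- by rewrite inE eqxx.
- by rewrite /= addnS -addSn.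
split=> // [|ns'].
  have eopE : edge_ops (visit c s v a) = edge_ops s.
    by rewrite /edge_ops /= -cats1 pmap_cat size_cat addn0.
  (* If visiting [v] already triggers the stop, no edge is read and [v] is not settled. *)
  case: (boolP (stopped nu (visit c s v a))) => st.
    rewrite (dfs_reach_stopped r st) eopE leq_add2l /settled_deg /settled st.
    by rewrite (negPf ns).
  have dE : settled_deg (visit c s v a) = size (nbr v) + settled_deg s.
    rewrite /settled_deg /settled (negPf st) (negPf ns).
    by rewrite -[visited (visit c s v a)]/(v :: visited s) big_cons.
  by move: le; rewrite eopE dE; simpl; lia.
have [clA clB] := cl ns' => p pe tp ntp.
case: (boolP (etail R p \in visited (visit c s v a))) => t2; last exact: clA.
apply: clB; rewrite mem_nbr pe /=.
by move: t2; rewrite inE (negPf ntp) orbF.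
Qed.

(** [inv_settled] survives the stop because the triggering vertex is left out. For the sizes: every
    vertex but the root is reached by an edge read, every edge read comes with a read of its head,
    and every visit adds one operation. *)
Record dfs_inv s : Prop := DfsInv {
  inv_uniq : uniq (visited s);
  inv_csum : csum s = \sum_(v <- visited s) c v;
  inv_settled : \sum_(v <- settled s) c v < 8 * nu;
  inv_wf : tree_wf e x R (tree s);
  inv_vertex : {subset pmap (@op_vertex V) (dtrace s) <= visited s};
  inv_edge : forall p, p \in pmap (@op_edge V) (dtrace s) ->
    p \in edges e /\ etail R p \in settled s;
  inv_size_tree : size (tree s) <= (edge_ops s).+1;
  inv_size_trace : size (dtrace s) = size (tree s) + 2 * edge_ops s
}.

Definition dfs_init : dfs_state V := DfsState [::] 0 [::].
Definition search : dfs_state V := Defs.dfs nu #|V| c R nbr dfs_init x None.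

Hypothesis nu_gt0 : 0 < nu.

Lemma dfs_inv_visit0 : dfs_inv (visit c dfs_init x None).
Proof.
have lt0 : 0 < 8 * nu by rewrite muln_gt0.
split=> //=; rewrite ?eqxx //.
- by rewrite big_seq1.
- rewrite /settled /=; case: ifPn => /=; rewrite ?big_nil //.
  by rewrite /stopped /= -ltnNge big_seq1.
Qed.

Lemma dfs_inv_reach s s' : dfs_reach s s' -> dfs_inv s -> dfs_inv s'.
Proof.
elim=> {s'} // [s1 p _ IH ns pe tp hp /IH i1|s1 p _ IH ns pe tp hp /IH i1].
  have eopE : edge_ops (probe s1 p) = (edge_ops s1).+1.
    by rewrite /edge_ops /= pmap_cat size_cat addn1.
  case: i1 => *; split=> //; rewrite ?eopE //=.
  - move=> v; rewrite pmap_cat mem_cat => /orP[|/=]; first by auto.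
    by rewrite inE => /eqP->.
  - move=> q; rewrite pmap_cat mem_cat => /orP[|/=]; first by auto.
    rewrite inE => /eqP->; split=> //.
    by rewrite -[settled _]/(settled s1) /settled (negPf ns).
  - by rewrite leqW.
  - by rewrite size_cat /=; lia.
have eopE : edge_ops (visit c (probe s1 p) (ehead R p) (Some p)) = (edge_ops s1).+1.
  by rewrite /edge_ops /= -cats1 !pmap_cat !size_cat /= addn1 addn0.
have sub : {subset visited s1 <=
    settled (visit c (probe s1 p) (ehead R p) (Some p))}.
  by move=> v vs; rewrite /settled; case: ifP => _ //; rewrite inE vs orbT.
case: i1 => us cs lt wf ov oe st sd; split; rewrite ?eopE //=.
- by rewrite hp.
- by rewrite big_cons -cs addnC.
- rewrite /settled; case: ifPn => /= [_|]; rewrite -?cs.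
    by move: ns; rewrite /stopped -ltnNge.
  by rewrite /stopped /= -ltnNge big_cons -cs addnC.
- by rewrite pe eqxx tp wf.
- move=> v; rewrite -cats1 !pmap_cat !mem_cat /= !inE -orbA => /or3P[/ov->|->|->] //.
  by rewrite orbT.
- move=> q; rewrite -cats1 !pmap_cat !mem_cat /= orbF mem_seq1 => /orP[|/eqP->].
    by case/oe => qe tq; split=> //; apply: sub; move: tq; rewrite /settled (negPf ns).
  by split=> //; apply: sub.
- by rewrite size_rcons size_cat /=; lia.
Qed.

Lemma search_reach : dfs_reach (visit c dfs_init x None) search /\
  edge_ops search <= settled_deg search /\
  (~~ stopped nu search ->
   forall p, p \in edges e -> etail R p \in visited search ->
             ehead R p \in visited search).
Proof.
have [|//|//||r le cl] := @dfs_correct #|V| dfs_init x None.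
- by rewrite /stopped /= leqn0 muln_eq0 /= -lt0n.
- by rewrite addn0.
split=> //; split=> [|/cl cl' p pe tp]; last exact: cl'.
suff D0 : settled_deg dfs_init = 0 by move: le; rewrite D0 addn0.
by rewrite /settled_deg /settled /=; case: ifP; rewrite big_nil.
Qed.

Lemma search_inv : dfs_inv search.
Proof. exact: dfs_inv_reach (proj1 search_reach) dfs_inv_visit0. Qed.

Lemma search_start : x \in visited search.
Proof. by apply: (dfs_reach_visited (proj1 search_reach)); rewrite inE eqxx. Qed.

Lemma search_edge_ops :
  edge_ops search <= #|[set p in edges e | etail R p \in settled search]|.
Proof.
apply: leq_trans (proj1 (proj2 search_reach)) _.
have us : uniq (settled search).
  have := inv_uniq search_inv; rewrite /settled; case: ifP => // _.
  by case: (visited _) => //= v vs /andP[].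
rewrite /settled_deg big_uniq //=.
rewrite card_edges_by; apply: leq_sum => v _.
by rewrite (perm_size (nbrP v)) -cardE.
Qed.

Lemma crossing_visited s tau : x \in visited s -> crossing x c tau s \in visited s.
Proof.
rewrite /crossing; set vs := rev _; set j := find _ _ => xs.
(* If no prefix reaches [tau], the default value [x] of [nth] is returned, which is visited too. *)
case: (ltnP j (size vs)) => [/(mem_nth x)|/(nth_default x) -> //].
by rewrite mem_rev.
Qed.

(** The values of [tau] with a given crossing vertex lie between the capacity sums just before and
    just after it in the order of visit; [uniq] lets [index] recover its position. *)
Lemma crossing_bounds s tau : 0 < tau -> tau <= \sum_(v <- visited s) c v ->
  let vs := rev (visited s) in
  let j := index (crossing x c tau s) vs in
  uniq vs ->
  \sum_(v <- take j vs) c v < tau <= \sum_(v <- take j.+1 vs) c v.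
Proof.
move=> t0; rewrite -big_rev /=.
rewrite /crossing; set vs := rev _ => tle uvs.
pose P i := tau <= \sum_(v <- take i.+1 vs) c v; rewrite -/P.
have m0 : 0 < size vs.
  by case E: vs tle => //; rewrite big_nil leqNgt t0.
have hasP : has P (iota 0 (size vs)).
  apply/hasP; exists (size vs).-1; first by rewrite mem_iota /= add0n ltn_predL.
  by rewrite /P prednK // take_size.
have jlt : find P (iota 0 (size vs)) < size vs.
  by rewrite -[X in _ < X](size_iota 0) -has_find.
rewrite index_uniq //.
have := nth_find 0 hasP; rewrite nth_iota // add0n => // Pj; apply/andP; split=> {Pj} //.
case E: (find _ _) jlt => [|i] ilt; first by rewrite take0 big_nil.
have := @before_find _ 0 P (iota 0 (size vs)) i; rewrite E ltnS leqnn => /(_ isT).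
by rewrite nth_iota ?(ltnW ilt) // add0n /P ltnNge => ->.
Qed.

End DepthFirst.

(** * Counting values of tau and sequences of coin tosses *)

Lemma card_ord_between N a b : #|[set i : 'I_N | a <= i < b]| <= b - a.
Proof.
rewrite cardE -(size_map val) -(size_iota a (b - a)); apply: uniq_leq_size.
  by rewrite map_inj_uniq ?enum_uniq //; apply: val_inj.
move=> _ /mapP[i + ->]; rewrite mem_enum inE mem_iota => /andP[ai ib].
by rewrite ai subnKC // ltnW // (leq_ltn_trans ai ib).
Qed.

(* The values of tau whose crossing vertex is v are as many as the units of
   capacity that the iteration removes from v. *)
Lemma card_crossing (V : finType) (x : V) (nu : nat) (c : V -> nat)
    (s : dfs_state V) (v : V) :
  x \in visited s -> uniq (visited s) -> csum s = \sum_(u <- visited s) c u ->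
  \sum_(u <- behead (visited s)) c u < 8 * nu -> stopped nu s ->
  #|[set i : 'I_(8 * nu) | crossing x c i.+1 s == v]| + new_cap x nu c s v <= c v.
Proof.
move=> xs us cE ltN; rewrite /stopped cE => leN.
(* [i] stands for the value [i.+1] of tau, which turns [a < tau <= b] into [a <= i < b]. *)
have bnd (i : 'I_(8 * nu)) : crossing x c i.+1 s == v ->
    let j := index v (rev (visited s)) in
    \sum_(u <- take j (rev (visited s))) c u <= i <
    \sum_(u <- take j.+1 (rev (visited s))) c u.
  move=> /eqP<-.
  have /= := @crossing_bounds _ x c s i.+1 isT _ _.
  by rewrite rev_uniq ltnS; apply=> //; apply: leq_trans leN.
case: (boolP (v \in visited s)) => vs; last first.
  rewrite /new_cap (contraNF (@mem_behead _ _ _) vs).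
  have -> : (v == head x (visited s)) = false.
    apply: contraNF vs => /eqP->; case: (visited s) xs => //= w t _.
    exact: mem_head.
  rewrite (_ : [set i | _] = set0) ?cards0 //; apply/setP => i; rewrite !inE.
  by apply: contraNF vs => /eqP<-; apply: crossing_visited.
(* The cap at [8 * nu] matters for the latest vertex, whose capacity may overshoot it. *)
have sub : #|[set i : 'I_(8 * nu) | crossing x c i.+1 s == v]| <=
   minn (8 * nu) (\sum_(u <- take (index v (rev (visited s))).+1 (rev (visited s))) c u)
    - \sum_(u <- take (index v (rev (visited s))) (rev (visited s))) c u.
  apply: leq_trans (card_ord_between (8 * nu) _ _); apply: subset_leq_card.
  apply/subsetP => i; rewrite !inE => /bnd /= /andP[-> lt].
  by rewrite leq_min ltn_ord.
have jlt : index v (rev (visited s)) < size (rev (visited s)).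
  by rewrite index_mem mem_rev.
have PS : \sum_(u <- take (index v (rev (visited s))).+1 (rev (visited s))) c u =
   \sum_(u <- take (index v (rev (visited s))) (rev (visited s))) c u + c v.
  by rewrite (take_nth x) // nth_index ?mem_rev // -cats1 big_cat /= big_seq1.
rewrite {}PS in sub.
rewrite /new_cap; case: ifPn => vt; first by lia.
(* Only the latest vertex remains: its interval runs from the sum of the earlier capacities to
   [8 * nu], and the overshoot is its new capacity. *)
move: sub ltN leN us vs vt; rewrite cE.
case: (visited s) => //= h t; rewrite rev_cons big_cons => sub ltN leN /andP[ht ut].
rewrite inE => /orP[/eqP vh|->//] _; rewrite {}vh eqxx in sub *.
move: sub; rewrite -cats1 index_cat mem_rev (negPf ht) /= eqxx addn0.
by rewrite take_size_cat // (big_rev _ t) /=; lia.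
Qed.

Lemma card_tuple_cons (T : finType) m (P : pred (seq T)) :
  #|[set t : m.+1.-tuple T | P t]| = \sum_a #|[set t : m.-tuple T | P (a :: t)]|.
Proof.
rewrite -sum1dep_card.
rewrite (reindex (fun p : T * m.-tuple T => [tuple of p.1 :: p.2])) /=; last first.
  exists (fun t => (thead t, [tuple of behead t])) => [[a t] _|t _] /=.
    by congr (_, _); apply: val_inj.
  by rewrite -tuple_eta.
rewrite -(pair_big_dep xpredT (fun a (t : m.-tuple T) => P (a :: t)) (fun _ _ => 1)).
by apply: eq_bigr => a _; rewrite sum1dep_card.
Qed.

(** Coin tosses are functions on ['I_k], whereas the induction over iterations peels off the first
    entry of a tuple. *)
Lemma card_ffun_tuple (T : finType) k (P : pred (seq T)) :
  #|[set w : {ffun 'I_k -> T} | P [seq w i | i <- enum 'I_k]]| =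
  #|[set t : k.-tuple T | P t]|.
Proof.
rewrite -!sum1dep_card.
rewrite (reindex (fun w : {ffun 'I_k -> T} => [tuple w i | i < k])) //=.
exists (fun t => [ffun i => tnth t i]) => [w _|t _].
  by apply/ffunP => i; rewrite ffunE tnth_mktuple.
by apply: eq_from_tnth => i; rewrite tnth_mktuple ffunE.
Qed.

(** * Iterations: soundness of the returned sets *)

Section Iterations.
Variables (V : finType) (e : rel V) (x : V) (nu : nat).
Variable scan : seq nat -> {set V * V} -> V -> seq (V * V).
Hypothesis scanP : forall h R v, perm_eq (scan h R v) (enum (out_edges e R v)).
Hypothesis nu_gt0 : 0 < nu.
Implicit Types (R : {set V * V}) (S : {set V}) (c : V -> nat).

Let found h R c := search x nu c R (scan h R).

Lemma found_inv h R c : dfs_inv e x nu c R (found h R c).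
Proof. exact: search_inv (scanP h R) nu_gt0. Qed.

Lemma found_start h R c : x \in visited (found h R c).
Proof. exact: search_start (scanP h R) nu_gt0. Qed.

Lemma cut_in_found h R c tau S : x \in S ->
  #|cut_in e (reverse_edges R (tree_path R (tree (found h R c))
      (crossing x c tau (found h R c)))) S|
   + (crossing x c tau (found h R c) \notin S) = #|cut_in e R S|.
Proof.
have inv := found_inv h R c.
apply: (cut_in_tree_path (inv_wf inv) (inv_uniq inv)).
by apply: crossing_visited; apply: found_start.
Qed.

Lemma found_closed h R c : ~~ stopped nu (found h R c) ->
  cut_in e R [set v in visited (found h R c)] = set0.
Proof.
have [_ [_ cl]] := search_reach x c (scanP h R) nu_gt0.
move=> /cl{}cl; apply/setP => p; rewrite in_set in_set0 /leaves !(in_set (mem _)).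
apply/negP => /andP[pe /andP[tp /negP]]; apply.
apply: cl => //; by rewrite inE.
Qed.

(** A returned set is closed in the graph of its own search. Each earlier reversal lowered its
    out-cut by at most one, and fewer than [size taus] reversals precede. *)
Lemma iterations_output h R c taus S :
  output (iterations x nu scan h R c taus) = Some S ->
  x \in S /\ #|cut_in e R S| < size taus.
Proof.
elim: taus h R c => [|tau taus IH] h R c //=.
rewrite -/dfs_init -/(search x nu c R (scan h R)) -/(found h R c).
case: ifPn => [st /=|ns [<-]]; last first.
  by rewrite inE found_start found_closed ?cards0.
case: taus IH => [//|tau' taus] IH /IH [xS lt]; split=> //.
rewrite -(cut_in_found h R c tau xS).
by apply: leq_ltn_trans (leq_add (leqnn _) (leq_b1 _)) _; rewrite addn1 ltnS.
Qed.

(** * Failure probability *)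

Lemma new_cap_sum h R c S : stopped nu (found h R c) ->
  #|[set i : 'I_(8 * nu) | crossing x c i.+1 (found h R c) \in S]| +
  \sum_(v in S) new_cap x nu c (found h R c) v <= \sum_(v in S) c v.
Proof.
move=> st; have inv := found_inv h R c.
rewrite -sum1dep_card (partition_big (fun i : 'I_(8 * nu) =>
  crossing x c i.+1 (found h R c)) (mem S)) //= -big_split /=.
apply: leq_sum => v vS.
have := @card_crossing _ x nu c (found h R c) v (found_start h R c) (inv_uniq inv)
  (inv_csum inv) _ st.
have := inv_settled inv; rewrite /settled st => lt /(_ lt).
apply: leq_trans; rewrite leq_add2r -sum1dep_card.
by rewrite (eq_bigl (fun i : 'I_(8 * nu) => crossing x c i.+1 (found h R c) == v)) //
  => i; rewrite andbC; case: eqP => // ->.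
Qed.

Definition failures m h R c : {set m.-tuple 'I_(8 * nu)} :=
  [set t : m.-tuple 'I_(8 * nu) | output (iterations x nu scan h R c [seq (nat_of_ord i).+1 | i <- t]) == None].

(* Either a crossing vertex lies in S, or every reversal lowers the out-cut of S
   by one, which leaves the last search confined to S. *)
Lemma card_failures m h R c S : x \in S -> #|cut_in e R S| < m ->
  #|failures m h R c| * (8 * nu) <= (8 * nu) ^ m * \sum_(v in S) c v.
Proof.
move=> xS; elim: m h R c => [//|m IH] h R c ltm.
have [st|ns] := boolP (stopped nu (found h R c)); last first.
  rewrite (_ : failures _ _ _ _ = set0) ?cards0 //; apply/setP => t; rewrite !inE.
  case/tupleP: t => i t /=.
  rewrite -/dfs_init -/(search x nu c R (scan h R)) -/(found h R c).
  by rewrite (negPf ns).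
case: m IH ltm => [_|m IH] ltm.
  have inv := found_inv h R c.
  (* The out-cut of [S] is now 0. Reversing the tree path to a visited vertex outside [S] would
     lower it by one, so no such vertex exists. *)
  have visS : {subset visited (found h R c) <= S}.
    move=> y yv; move: ltm; rewrite ltnS leqn0.
    rewrite -(cut_in_tree_path (inv_wf inv) (inv_uniq inv) yv xS).
    by rewrite addn_eq0 eqb0 negbK => /andP[].
  rewrite expn1 leq_mul //.
    by apply: leq_trans (max_card _) _; rewrite card_tuple card_ord expn1.
  (* The search collected [8 * nu] units, all inside [S], so the trivial bound on the number of
     failures suffices. *)
  apply: leq_trans st _; rewrite (inv_csum inv) big_uniq ?(inv_uniq inv) //=.
  rewrite [leqRHS](bigID (mem (visited (found h R c)))) /=.
  apply: leq_trans (leq_addr _ _); rewrite leq_eqVlt; apply/orP; left; apply/eqP.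
  by apply: eq_bigl => v; rewrite andb_idl // => /visS.
set s := found h R c.
pose h' (i : 'I_(8 * nu)) := rcons h i.+1.
pose R' (i : 'I_(8 * nu)) :=
  reverse_edges R (tree_path R (tree s) (crossing x c i.+1 s)).
have -> : #|failures m.+2 h R c| =
    \sum_i #|failures m.+1 (h' i) (R' i) (new_cap x nu c s)|.
  rewrite [LHS](card_tuple_cons _ (fun l : seq 'I_(8 * nu) =>
    output (iterations x nu scan h R c [seq (nat_of_ord i).+1 | i <- l]) == None)).
  apply: eq_bigr => i _; apply: eq_card => t.
  rewrite !inE; case/tupleP: t => j t /=.
  rewrite -/dfs_init -/(search x nu c R (scan h R)) -/(found h R c) -/s.
  by rewrite st.
set N := 8 * nu; set cS := \sum_(v in S) new_cap x nu c s v.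
(* If the crossing vertex is in [S], all continuations are counted as failures; otherwise the
   out-cut drops and induction applies with the new capacities. *)
have bnd i : #|failures m.+1 (h' i) (R' i) (new_cap x nu c s)| * N <=
    (crossing x c i.+1 s \in S) * N ^ m.+2 + N ^ m.+1 * cS.
  case: (boolP (_ \in S)) => yS.
    rewrite mul1n; apply: leq_trans (leq_addr _ _).
    rewrite [leqRHS]expnSr leq_mul2r; apply/orP; right.
    by apply: leq_trans (max_card _) _; rewrite card_tuple card_ord.
  rewrite mul0n add0n; apply: IH.
  by move: ltm; rewrite -(cut_in_found h R c i.+1 xS) yS addn1 ltnS.
rewrite big_distrl /=.
apply: (@leq_trans (\sum_(i < N)
    ((crossing x c i.+1 s \in S) * N ^ m.+2 + N ^ m.+1 * cS))).
  by apply: leq_sum => i _; apply: bnd.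
(* The sum is [N ^ m.+2] times the number of values of tau crossing in [S] plus the capacity left in
   [S]; this total is at most the old capacity of [S]. *)
rewrite big_split /= -big_distrl /= sum_nat_const card_ord mulnA -expnS mulnC -mulnDr.
rewrite leq_mul2l; apply/orP; right.
apply: leq_trans (new_cap_sum S st); rewrite leq_add2r -sum1dep_card.
rewrite [leqRHS]big_mkcond; apply: eq_leq; apply: eq_bigr => i _.
by rewrite -/s; case: (_ \in S).
Qed.

(** * Cost of the iterations *)

Lemma new_cap_le h R c v : stopped nu (found h R c) ->
  new_cap x nu c (found h R c) v <= c v.
Proof.
move=> st; have inv := found_inv h R c.
have := @card_crossing _ x nu c (found h R c) v (found_start h R c) (inv_uniq inv)
  (inv_csum inv) _ st.
have := inv_settled inv; rewrite /settled st => lt /(_ lt).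
by apply: leq_trans; rewrite leq_addl.
Qed.

Lemma sum_consumed h R c : stopped nu (found h R c) ->
  \sum_v (c v - new_cap x nu c (found h R c) v) <= 8 * nu.
Proof.
move=> st; have inv := found_inv h R c; have xs := found_start h R c.
rewrite (bigID (mem (visited (found h R c)))) /= [X in _ + X]big1 => [|v nv].
  rewrite addn0 -big_uniq ?(inv_uniq inv) //=.
  have := inv_settled inv; have := inv_uniq inv; move: st.
  rewrite /settled /stopped /new_cap => ->; rewrite (inv_csum inv).
  case: (visited _) xs => //= w t _ /andP[wt ut] lt.
  rewrite !big_cons (negPf wt) eqxx [X in _ + X <= _](eq_big_seq c) => [|v vt]; last first.
    by rewrite vt subn0.
  by move: lt; set T := bigop _ _ _; lia.
rewrite /new_cap (contraNF (@mem_behead _ _ _) nv).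
suff -> : (v == head x (visited (found h R c))) = false by rewrite subnn.
apply: contraNF nv => /eqP->; case: (visited _) xs => //= w t _; exact: mem_head.
Qed.

Lemma vol_outE S : vol_out e S = #|[set p in edges e | p.1 \in S]|.
Proof. by rewrite card_edges_by. Qed.

(** An exhausted vertex has its whole out-degree counted as consumed; a vertex of [A] contributes
    its remaining capacity as well. *)
Lemma vol_out_le c (A S : {set V}) : (forall v, c v <= outdeg e v) ->
  (forall v, v \in S -> c v = 0 \/ v \in A) ->
  vol_out e S <= \sum_v (outdeg e v - c v) + \sum_(v in A) c v.
Proof.
move=> cle SA; rewrite /vol_out big_mkcond [X in _ <= _ + X]big_mkcond -big_split /=.
apply: leq_sum => v _; case: ifP => // /SA [->|->]; first by rewrite subn0 leq_addr.
by rewrite subnK.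
Qed.

Lemma pmap_op_edge_vertex (vs : seq V) :
  pmap (@op_edge V) [seq OpVertex v | v <- vs] = [::].
Proof. by elim: vs. Qed.

Lemma pmap_op_vertex_edge (ps : seq (V * V)) :
  pmap (@op_vertex V) [seq OpEdge p | p <- ps] = [::].
Proof. by elim: ps. Qed.

Lemma pmap_op_edge (ps : seq (V * V)) :
  pmap (@op_edge V) [seq OpEdge p | p <- ps] = ps.
Proof. by elim: ps => //= p ps ->. Qed.

Lemma pmap_op_vertex (vs : seq V) :
  pmap (@op_vertex V) [seq OpVertex v | v <- vs] = vs.
Proof. by elim: vs => //= v vs ->. Qed.

(** [X] is meant for vertices that end up exhausted or are visited by a search that terminates
    normally, [Y] for the vertices that trigger a stop, which may keep some capacity. *)
Definition confined (X Y : {set V}) (tr : seq (op V)) : Prop :=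
  {subset pmap (@op_edge V) tr <= [set p in edges e | p.1 \in X]} /\
  {subset pmap (@op_vertex V) tr <= X :|: Y}.

Lemma confined_cat X Y tr1 tr2 :
  confined X Y tr1 -> confined X Y tr2 -> confined X Y (tr1 ++ tr2).
Proof.
move=> [e1 v1] [e2 v2]; split=> z; rewrite pmap_cat mem_cat => /orP[].
- exact: e1.
- exact: e2.
- exact: v1.
- exact: v2.
Qed.

(* A reversed edge starts, in its original orientation, at a vertex whose
   capacity has been exhausted, hence all edges read in an iteration start at
   vertices of capacity zero after this iteration. *)
Lemma search_cost h R c (X Y : {set V}) ps :
  let s := found h R c in
  (forall p, p \in R -> p.1 \in X) ->
  {subset settled nu s <= X} -> {subset visited s <= X :|: Y} ->
  (forall p, p \in ps -> p \in edges e /\ etail R p \in settled nu s) ->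
  size ps <= size (tree s) ->
  let tr := OpDraw :: dtrace s ++ [seq OpVertex v | v <- visited s] ++
            [seq OpEdge p | p <- ps] in
  confined X Y tr /\ size tr <= 4 + 5 * vol_out e X.
Proof.
move=> s RX sX vXY psP sps tr; have inv := found_inv h R c.
have edgeX p : p \in edges e -> etail R p \in settled nu s ->
    p \in [set q in edges e | q.1 \in X].
  move=> pe; rewrite in_set pe /etail; case: ifP => [/RX->//|_]; exact: sX.
split.
  split=> z; rewrite /= !pmap_cat !mem_cat.
    rewrite pmap_op_edge_vertex pmap_op_edge /= => /orP[/(inv_edge inv)[]|/psP[]];
    exact: edgeX.
  rewrite pmap_op_vertex pmap_op_vertex_edge in_nil orbF => /orP[/(inv_vertex inv)|];
  exact: vXY.
have le : edge_ops s <= vol_out e X.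
  apply: leq_trans (search_edge_ops x c (scanP h R) nu_gt0) _.
  rewrite vol_outE; apply: subset_leq_card; apply/subsetP => p; rewrite in_set.
  by case/andP; apply: edgeX.
(* One draw, at most three times the tree size and two operations per edge read; the tree size is at
   most one more than the number of edge reads, whence 4 and 5. *)
have := inv_size_tree inv; have := inv_size_trace inv; rewrite -/s => sd st.
rewrite /tr /= !size_cat !size_map sd; move: sps le st.
by move: (size ps) (size (tree s)) (edge_ops s) (vol_out e X) => a b d f; lia.
Qed.

(** Capacities never increase, so one final set [X] serves all iterations. Each iteration consumes
    at most [8 * nu] units and adds at most one vertex to [Y]. *)
Lemma iterations_cost taus h R c :
  (forall v, c v <= outdeg e v) -> (forall p, p \in R -> c p.1 = 0) ->
  let r := iterations x nu scan h R c taus in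
  exists X Y : {set V},
  [/\ forall v, c v = 0 -> v \in X,
      vol_out e X <= \sum_v (outdeg e v - c v) + 8 * nu * size taus,
      #|Y| <= size taus,
      confined X Y (trace r)
    & size (trace r) <= size taus * (4 + 5 * vol_out e X)].
Proof.
elim: taus h R c => [|tau taus IH] h R c cle R0 /=.
  exists [set v | c v == 0], set0; rewrite muln0; split=> //.
  - by move=> v cv; rewrite inE cv.
  - have := @vol_out_le c set0 _ cle; rewrite big_set0; apply=> v.
    by rewrite inE => /eqP; left.
  - by rewrite cards0.
rewrite -/dfs_init -/(search x nu c R (scan h R)) -/(found h R c).
have inv := found_inv h R c; set s := found h R c.
case: ifPn => [st|ns] /=; last first.
  (* A search that ends normally has all its vertices settled, with total capacity below [8 * nu],
     so they can all be put into [X]. *)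
  pose X : {set V} := [set v | (c v == 0) || (v \in visited s)].
  have sE : settled nu s = visited s by rewrite /settled (negPf ns).
  have [|||//|//|cf sz] := @search_cost h R c X set0 [::].
  - by move=> p /R0 cp; rewrite inE cp.
  - by move=> v; rewrite sE => vs; rewrite inE vs orbT.
  - by move=> v vs; rewrite !inE vs orbT.
  move: cf sz; rewrite /= cats0 -/s => cf sz.
  exists X, set0; split=> //.
  - by move=> v cv; rewrite inE cv.
  - apply: leq_trans (vol_out_le (A := [set v in visited s]) cle _) _ => [v|].
      by rewrite !inE => /orP[/eqP|]; [left|right].
    rewrite leq_add2l; have := inv_settled inv; rewrite -/s sE.
    rewrite big_uniq ?(inv_uniq inv) //= => lt.
    rewrite (eq_bigl (mem (visited s))) => [|v]; last by rewrite inE.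
    by apply: leq_trans (ltnW lt) _; rewrite leq_pmulr.
  - by rewrite cards0.
  - by apply: leq_trans sz _; rewrite leq_pmull.
set c' := new_cap x nu c s.
set ps := if taus is [::] then [::] else _.
have c'c v : c' v <= c v by apply: new_cap_le.
have sE : settled nu s = behead (visited s) by rewrite /settled st.
have c's v : v \in settled nu s -> c' v = 0.
  by rewrite sE /c' /new_cap => ->.
have psP p : p \in ps -> p \in edges e /\ etail R p \in settled nu s.
  rewrite /ps; case: (taus) => // _ _ /(tree_path_edges (inv_wf inv))[pe tp _].
  by rewrite sE.
have sps : size ps <= size (tree s).
  by rewrite /ps; case: (taus) => // _ _; exact: size_tree_path.
have c'le v : c' v <= outdeg e v by apply: leq_trans (c'c v) (cle v).
have R'0 p : p \in reverse_edges R ps -> c' p.1 = 0.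
  rewrite inE; case: (boolP (p \in R)) => [/R0 cp _|pR /= /psP[_]].
    by apply/eqP; rewrite -leqn0 -cp.
  by rewrite /etail (negPf pR) => /c's.
have [X [Y [X0 vol cY cf sz]]] := IH (rcons h tau) _ _ c'le R'0.
have [|||//|//|cf1 sz1] := @search_cost h R c X (head x (visited s) |: Y) ps.
- by move=> p /R0 cp; apply: X0; apply/eqP; rewrite -leqn0 -cp.
- by move=> v /c's; apply: X0.
- move=> v vs; case: (boolP (v \in settled nu s)) => [/c's/X0|].
    by rewrite inE => ->.
  rewrite sE; move: vs; case: (visited s) => //= w t; rewrite !inE.
  by case: eqP => //= [_ _ _|_ ->//]; rewrite orbT.
have trE t : OpDraw :: (dtrace s ++ [seq OpVertex v | v <- visited s]) ++
    [seq OpEdge p | p <- ps] ++ t =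
    (OpDraw :: dtrace s ++ [seq OpVertex v | v <- visited s] ++
     [seq OpEdge p | p <- ps]) ++ t by rewrite /= -!catA.
exists X, (head x (visited s) |: Y); split.
- by move=> v cv; apply: X0; apply/eqP; rewrite -leqn0 -cv.
- have := sum_consumed st; rewrite -/s -/c' => le8.
  have -> : \sum_v (outdeg e v - c v) + 8 * nu * (size taus).+1 =
      (\sum_v (outdeg e v - c v) + 8 * nu) + 8 * nu * size taus.
    by rewrite mulnS addnA.
  apply: leq_trans vol _; rewrite leq_add2r.
  apply: leq_trans (leq_add (leqnn _) le8); rewrite -big_split /=.
  apply: leq_sum => v _.
  by have := c'c v; have := cle v; clear; lia.
- by rewrite cardsU1 -add1n; apply: leq_add => //; apply: leq_b1.
- rewrite trE; apply: confined_cat => //.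
  by case: cf => ce cv; split=> // v /cv; rewrite !inE => /orP[->|->]; rewrite ?orbT.
- rewrite -[leqLHS]/(size (OpDraw :: _)) trE mulSn size_cat; exact: leq_add.
Qed.

End Iterations.

(** * Assembly: the LocalEC guarantee and the complexity bounds *)

Lemma min_vertexP (V : finType) (e : rel V) (x v : V) :
  min_outdeg e x <= outdeg e v.
Proof.
rewrite /min_outdeg /min_vertex; case: arg_minnP => // w _; exact.
Qed.

Lemma LocalEC_iterations (I : instance) : 0 < nu I ->
  LocalEC_at Local2_iterations I.
Proof.
move=> nu0; split=> [w S /(iterations_output (@scan_perm I) nu0)[xS]|].
  by rewrite cut_in0 size_map size_enum_ord.
move=> [S [_ xS vol cut]].
have := @card_failures _ (adj I) (start I) (nu I) (scan I) (@scan_perm I) nu0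
  (conn I) [::] set0 (outdeg (adj I)) S xS.
rewrite cut_in0 => /(_ cut).
have -> : #|failures (start I) (nu I) (scan I) (conn I) [::] set0 (outdeg (adj I))| =
   #|[set w : coins Local2_iterations I | output (exec Local2_iterations I w) == None]|.
  rewrite -(card_ffun_tuple _ (fun l : seq 'I_(8 * nu I) =>
    output (iterations (start I) (nu I) (scan I) [::] set0 (outdeg (adj I))
      [seq (nat_of_ord i).+1 | i <- l]) == None)).
  by apply: eq_card => w; rewrite !inE -map_comp.
rewrite /Pr; set A := [set _ | _] => le.
have -> : #|coins Local2_iterations I| = (8 * nu I) ^ conn I.
  by rewrite card_ffun !card_ord.
have lt0 : 0 < (8 * nu I) ^ conn I by rewrite expn_gt0 muln_gt0 nu0.
(* Initially the capacity of [S] is its volume, at most [nu]; the failure rate is thus at most 1/8,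
   more than enough for 1/2. *)
have le2 : #|A| * 2 <= (8 * nu I) ^ conn I.
  have : #|A| * (8 * nu I) <= (8 * nu I) ^ conn I * nu I.
    by apply: leq_trans le _; rewrite leq_mul2l; apply/orP; right.
  rewrite mulnA leq_pmul2r //; apply: leq_trans.
  by rewrite leq_mul2l orbT.
rewrite GRing.mul1r Num.Theory.ler_pdivrMr ?Num.Theory.ltr0n //.
by rewrite GRing.mulrC Num.Theory.ler_pdivlMr ?Num.Theory.ltr0n //
  -GRing.natrM Num.Theory.ler_nat.
Qed.

Lemma cut_trivial (I : instance) :
  #|cut_edges (adj I) (trivial_cut I) (~: trivial_cut I)| <= instance_min_outdeg I.
Proof.
apply: subset_leq_card; apply/subsetP => p; rewrite !inE.
by case/andP => -> /andP[-> _].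
Qed.

Lemma Local2_iterations_cost (I : instance) : 0 < nu I ->
  conn I <= instance_min_outdeg I -> forall w : coins Local2_iterations I,
  let r := exec Local2_iterations I w in
  [/\ run_time r <= 44 * (nu I * conn I ^ 2),
      run_edges r <= 8 * (nu I * conn I)
    & run_vertices r <= 8 * nu I + conn I].
Proof.
move=> nu0 kmin w r.
set taus := [seq (w i : nat).+1 | i <- enum 'I_(conn I)].
have szt : size taus = conn I by rewrite size_map size_enum_ord.
have [|X [Y [_]]] := @iterations_cost _ (adj I) (start I) (nu I) (scan I)
  (@scan_perm I) nu0 taus [::] set0 (outdeg (adj I)) (fun _ => leqnn _).
  by move=> p; rewrite inE.
rewrite -[iterations _ _ _ _ _ _ _]/r.
rewrite szt big1 => [|v _]; last by rewrite subnn.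
rewrite add0n -mulnA => vol cY [ce cv] time.
have leE : run_edges r <= vol_out (adj I) X.
  rewrite vol_outE cardE; apply: uniq_leq_size; first exact: undup_uniq.
  by move=> p; rewrite mem_undup mem_enum => /ce.
have leV : run_vertices r <= #|X| + #|Y|.
  apply: leq_trans (_ : #|X :|: Y| <= _); last by rewrite cardsU leq_subr.
  rewrite cardE; apply: uniq_leq_size; first exact: undup_uniq.
  by move=> v; rewrite mem_undup mem_enum => /cv.
(* The reduced [k] is 0 if some vertex has no out-edge; then no iteration is run. *)
have [k0|k0] := posnP (conn I).
  have tr0 : trace r = [::].
    by apply/nilP; rewrite /nilp -leqn0; move: time; rewrite k0 mul0n.
  by rewrite /run_time /run_edges /run_vertices tr0.
(* Every out-degree is at least [k], so the volume bound [8 * nu * k] can be divided by [k]. *)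
have cX : #|X| <= 8 * nu I.
  rewrite -(leq_pmul2r k0) -mulnA; apply: leq_trans vol.
  rewrite /vol_out -sum_nat_const; apply: leq_sum => v _.
  exact: leq_trans kmin (min_vertexP _ _ _).
split.
- apply: leq_trans time _.
  have le1 : 1 <= nu I * conn I by rewrite muln_gt0 nu0.
  (* 44 is 4 + 5 * 8, using [1 <= nu * k]. *)
  have le44 : 4 + 5 * vol_out (adj I) X <= 44 * (nu I * conn I).
    by move: vol le1; move: (vol_out _ _) (nu I * conn I) => a b; lia.
  apply: leq_trans (leq_mul (leqnn _) le44) _.
  by rewrite mulnCA [conn I * (_ * _)]mulnCA -mulnn.
- exact: leq_trans leE vol.
- by apply: leq_trans leV _; apply: leq_add.
Qed.

Lemma Local2plus_cost (I : instance) : 0 < nu I -> forall w : coins Local2plus I,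
  let k := minn (conn I) (instance_min_outdeg I) in
  let r := exec Local2plus I w in
  [/\ run_time r <= 44 * (nu I * k ^ 2) + 1,
      run_edges r <= 8 * (nu I * k)
    & run_vertices r <= 8 * nu I + k + 1].
Proof.
move=> nu0 w k r.
have [] := @Local2_iterations_cost (reduced I) nu0 (geq_minr _ _) w.
rewrite /r /=; set r0 := iterations _ _ _ _ _ _ _ => t e v.
case: ifP => _; last by split; rewrite // (leq_trans _ (leq_addr _ _)).
split.
- by rewrite /run_time /= size_rcons addn1 ltnS.
- by rewrite /run_edges /= -cats1 pmap_cat cats0.
- rewrite /run_vertices /= -cats1 pmap_cat /=.
  apply: leq_trans (_ : size (min_vertex (adj I) (start I) ::
     undup (pmap (@op_vertex _) (trace r0))) <= _); last by rewrite addn1 ltnS.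
  apply: uniq_leq_size; first exact: undup_uniq.
  by move=> u; rewrite mem_undup mem_cat mem_seq1 in_cons mem_undup orbC.
Qed.

Theorem theorem6 (C0 C1 : nat) :
  (* correctness when k needs no reduction *)
  LocalEC (fun I => admissible C0 I /\ conn I <= instance_min_outdeg I)
    Local2plus /\
  (* correctness when k is replaced by the minimum out-degree *)
  (forall I : instance,
     admissible C0 I -> instance_min_outdeg I < conn I ->
     LocalEC_at Local2_iterations (reduced I) /\
     forall w : coins Local2plus I, exists S : {set vert I},
       [/\ output (exec Local2plus I w) = Some S,
           #|cut_edges (adj I) S (~: S)| < conn I
         & output (exec Local2_iterations (reduced I) w) = Some S \/
           output (exec Local2_iterations (reduced I) w) = None /\
           S = trivial_cut I]) /\
  (* (nu k^2, nu k, nu)-complexity *)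
  cost_bigO (admissible C0) Local2plus run_time
    (fun I => nu I * conn I ^ 2) /\
  cost_bigO (admissible C0) Local2plus run_edges
    (fun I => nu I * conn I) /\
  cost_bigO
    (fun I => admissible C0 I /\
       minn (conn I) (instance_min_outdeg I) <= C1 * nu I)
    Local2plus run_vertices (fun I => nu I).
Proof.
split; [|split; [|split; [|split]]].
- move=> I [[nu0 _ _] kmin]; have [out fail] := @LocalEC_iterations (reduced I) nu0.
  have nlt : (instance_min_outdeg I < conn I) = false by rewrite ltnNge kmin.
  have kE : conn (reduced I) = conn I by apply/minn_idPl.
  have runE (w : coins Local2plus I) :
      exec Local2plus I w = exec Local2_iterations (reduced I) w.
    by rewrite /= nlt andbF.
  split=> [w S|exS]; first by rewrite runE -kE; apply: out.
  have -> : Pr (fun w : coins Local2plus I => output (exec Local2plus I w) == None) =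
      Pr (fun w : coins Local2_iterations (reduced I) =>
        output (exec Local2_iterations (reduced I) w) == None).
    by congr (_%:R / _)%R; apply: eq_card => w; rewrite !inE runE.
  by apply: fail; rewrite kE.
(* The trivial cut need not contain [x], but its out-cut is at most the minimum out-degree, which is
   below [k]. *)
- move=> I [nu0 _ _] lt; have LE := @LocalEC_iterations (reduced I) nu0.
  split=> // w.
  case E : (output (exec Local2_iterations (reduced I) w)) => [S|].
    exists S; split; [by rewrite /= E| |by left].
    by apply: leq_trans (proj2 (proj1 LE w S E)) (geq_minl _ _).
  exists (trivial_cut I); split; [by rewrite /= E lt| |by right].
  exact: leq_ltn_trans (cut_trivial I) lt.
(* The extra unit pays for accessing the vertex of the trivial cut. *)
- exists 45 => I [nu0 k0 _] w; have [t _ _] := Local2plus_cost nu0 w.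
  apply: leq_trans t _; rewrite -[45]/(44 + 1) mulnDl leq_add //.
    by rewrite leq_mul2l leq_mul2l leq_exp2r // geq_minl orbT.
  by rewrite mul1n muln_gt0 nu0 expn_gt0 k0.
- exists 8 => I [nu0 _ _] w; have [_ le _] := Local2plus_cost nu0 w.
  by apply: leq_trans le _; rewrite !leq_mul2l geq_minl !orbT.
(* 8 for the vertices in [X], [C1] for the at most one stopping vertex per iteration, and 1 for the
   trivial cut. *)
- exists (9 + C1) => I [[nu0 _ _] kC] w; have [_ _ le] := Local2plus_cost nu0 w.
  apply: leq_trans le _; rewrite -addnA -[9]/(8 + 1) -addnA mulnDl leq_add2l.
  by rewrite mulnDl addnC leq_add // mul1n.
Qed.
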